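(* Let $n\ge 1$, let $X_1,\dots,X_n,X'_1,\dots,X'_n$ be independent real random variables with $X_k$ and $X'_k$ identically distributed for each $k$, let $S:\mathbb{R}^n\to\mathbb{R}$ be Borel with $\mathbb{E}\,S(X_1,\dots,X_n)^2<+\infty$, write $S=S(X_1,\dots,X_n)$, and let $J'_k,K'_k$ ($1\le k\le n$) be as defined in the context. Then $$\mathrm{Var}\,S=J'_1-J'_2+\dots+(-1)^{n-1}J'_n=K'_1+K'_2+\dots+K'_n,$$ and for all $k\in\{1,\dots,n-1\}$: $$K'_{k+1}\le(-1)^k\left(\mathrm{Var}\,S-J'_1+J'_2-\dots+(-1)^kJ'_k\right)\le J'_{k+1},$$ $$K'_{k+1}\le\mathrm{Var}\,S-K'_1-K'_2-\dots-K'_k\le J'_{k+1},$$ $$\mathrm{Var}\,S=J'_1-J'_2+\dots+(-1)^{k-1}J'_k+(-1)^k\sum_{j=k+1}^n\binom{j-1}{k}K'_j,$$ $$\mathrm{Var}\,S=\sum_{j=1}^k(-1)^{j-1}\frac{\binom{k}{j}}{\binom{n}{j}}J'_j+\sum_{j=1}^{n-k}\frac{\binom{n-k}{j}}{\binom{n}{j}}K'_j.$$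
   Context: For $Y$ measurable with respect to $\sigma(X_1,\dots,X_n)$ and $\alpha\subset\{1,\dots,n\}$, let $\mathbb{E}^{\alpha}Y:=\mathbb{E}(Y\mid (X_j)_{j\notin\alpha})$ (so $\mathbb{E}^\emptyset Y=Y$ and $\mathbb{E}^{\{1,\dots,n\}}Y=\mathbb{E}Y$), and $\mathbb{E}^{(i)}:=\mathbb{E}^{\{i\}}$. For $i\in\{1,\dots,n\}$ let $\mathrm{Var}^{(i)}Y:=\mathbb{E}^{(i)}Y^2-(\mathbb{E}^{(i)}Y)^2$ and, iterating, for distinct $i_1,\dots,i_k$, $$\mathrm{Var}^{(i_1,\dots,i_k)}Y:=\mathbb{E}^{(i_1)}(\mathrm{Var}^{(i_2,\dots,i_k)}Y)-\mathrm{Var}^{(i_2,\dots,i_k)}(\mathbb{E}^{(i_1)}Y),$$ which depends only on the set $\{i_1,\dots,i_k\}$. For $k\in\{1,\dots,n\}$, $$J_k:=\mathbb{E}\sum\mathrm{Var}^{(i_1,\dots,i_k)}S,\qquad K_k:=\mathbb{E}\sum\mathrm{Var}^{(i_1,\dots,i_k)}\,\mathbb{E}^{\{1,\dots,n\}\setminus\{i_1,\dots,i_k\}}S,$$ both sums running over ordered $k$-tuples $(i_1,\dots,i_k)$ of pairwise distinct elements of $\{1,\dots,n\}$; and $J'_k:=J_k/k!$, $K'_k:=K_k/k!$. *)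

(* Defs.v *)
From HB Require Import structures.
From mathcomp Require Import all_boot all_order all_algebra.
From mathcomp Require Import all_classical all_reals all_analysis.

Set Implicit Arguments.
Unset Strict Implicit.
Unset Printing Implicit Defensive.

Import Order.TTheory GRing.Theory Num.Theory.
Import numFieldNormedType.Exports.

Local Open Scope classical_set_scope.
Local Open Scope ring_scope.

Section independence.
Context {d : measure_display} {T : measurableType d} {R : realType}.
Variable P : probability T R.

Definition mutually_independent (I : finType) (X : I -> {RV P >-> R}) : Prop :=
  forall (J : {set I}) (B : I -> set R), (forall i, measurable (B i)) ->
    P (\bigcap_(i in [set` J]) (X i @^-1` B i)) =
    (\prod_(i in J) P (X i @^-1` B i))%E.

Definition identically_distributed (X Y : {RV P >-> R}) : Prop :=
  forall B : set R, measurable B -> distribution P X B = distribution P Y B.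

(* The 2n variables X_1, ..., X_n, X'_1, ..., X'_n as a single family. *)
Definition join_family (n : nat) (X X' : 'I_n -> {RV P >-> R})
    (i : 'I_n + 'I_n) : {RV P >-> R} :=
  match i with inl k => X k | inr k => X' k end.

End independence.

Section conditional_expectation.
Context {d : measure_display} {T : measurableType d} {R : realType}.
Variable P : probability T R.

Definition is_condexp (G : set (set T)) (Y Z : T -> R) : Prop :=
  [/\ forall B : set R, measurable B -> G (Z @^-1` B),
      P.-integrable setT (EFin \o Z) &
      forall A, G A ->
        (\int[P]_(w in A) (Z w)%:E = \int[P]_(w in A) (Y w)%:E)%E].

(* A version of E(Y | G), chosen classically; it is determined up to
   P-negligible sets when Y is integrable and G is a sub-sigma-algebra. The
   default value 0 is only taken when no version exists. *)
Definition condexp (G : set (set T)) (Y : T -> R) : T -> R :=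
  xget (cst 0) [set Z | is_condexp G Y Z].

End conditional_expectation.

Section conditional_variances.
Context {d : measure_display} {T : measurableType d} {R : realType}.
Variable P : probability T R.
Variables (n : nat) (X : 'I_n -> {RV P >-> R}).

(* sigma((X_j)_{j \notin alpha}) *)
Definition sigma_off (alpha : {set 'I_n}) : set (set T) :=
  <<s \bigcup_(j in [set j | j \notin alpha])
        preimage_set_system setT (X j) measurable >>.

(* E^alpha Y: integrates out the coordinates in alpha. *)
Definition cE (alpha : {set 'I_n}) (Y : T -> R) : T -> R :=
  condexp P (sigma_off alpha) Y.

(* Var^(i_1, ..., i_k) Y for s = [:: i_1; ...; i_k]; only k >= 1 is
   meaningful. *)
Fixpoint cVar (s : seq 'I_n) (Y : T -> R) : T -> R :=
  match s with
  | [::] => cst 0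
  | [:: i] =>
      fun w => cE [set i]%SET (fun x => Y x ^+ 2) w - cE [set i]%SET Y w ^+ 2
  | i :: s' =>
      fun w => cE [set i]%SET (cVar s' Y) w - cVar s' (cE [set i]%SET Y) w
  end.

Definition J (Y : T -> R) (k : nat) : R :=
  fine 'E_P[fun w => \sum_(t : k.-tuple 'I_n | uniq t) cVar t Y w].

Definition K (Y : T -> R) (k : nat) : R :=
  fine 'E_P[fun w => \sum_(t : k.-tuple 'I_n | uniq t)
                       cVar t (cE (~: [set i in t])%SET Y) w].

Definition J' (Y : T -> R) (k : nat) : R := J Y k / k`!%:R.

Definition K' (Y : T -> R) (k : nat) : R := K Y k / k`!%:R.

End conditional_variances.

(* Main.v *)
Require Import Defs.
From HB Require Import structures.
From mathcomp Require Import all_boot all_order all_algebra.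
From mathcomp Require Import all_classical all_reals all_analysis.
From mathcomp Require Import measurable_realfun ring lra zify.

Set Implicit Arguments.
Unset Strict Implicit.
Unset Printing Implicit Defensive.

Import Order.TTheory GRing.Theory Num.Theory.
Import numFieldNormedType.Exports.

Local Open Scope classical_set_scope.
Local Open Scope ring_scope.

(* Under independence the operators E^a are commuting orthogonal projections of
   L^2 with E^a E^b = E^(a :|: b). Writing g(a) = ||E^a S||^2, the recursion for
   the iterated conditional variance gives, for distinct coordinates s,
     E Var^s S = sum_(u \subset s) (-1)^|u| g(u)
               = ||prod_(i in s) (1 - E^i) S||^2.
   Let c(A) >= 0 be the squared norm of the Hoeffding component of S indexed by
   A, that is E Var^A E^(~A) S. Moebius inversion yields
   E Var^s S = sum_(A \supset s) c(A) and Var S = sum_(A <> set0) c(A), so that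
     J'_k = sum_A 'C(|A|, k) c(A)  and  K'_k = sum_(|A| = k) c(A),
   and each assertion reduces to an identity or inequality between binomial
   coefficients evaluated at m = |A|. *)

(** * Signed sums over subsets *)

Section subset_sums.
Variables (R : realFieldType) (n : nat).
Implicit Types (A B C u : {set 'I_n}) (g F : {set 'I_n} -> R).

Lemma sum_subset_setU1 (i : 'I_n) A F : i \notin A ->
  \sum_(u : {set 'I_n} | u \subset i |: A) F u =
  \sum_(u : {set 'I_n} | u \subset A) F u +
  \sum_(u : {set 'I_n} | u \subset A) F (i |: u)%SET.
Proof.
move=> ia; rewrite (bigID (fun u : {set 'I_n} => i \notin u)) /=; congr (_ + _).
  apply: eq_bigl => u; apply/andP/idP => [[uia iu]|ua].
    by rewrite -(finset.setU1K ia) finset.subsetD1 uia.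
  split; first exact: fintype.subset_trans ua (finset.subsetUr _ _).
  by apply: contra ia; apply: (fintype.subsetP ua).
rewrite (reindex_onto (fun u => i |: u)%SET (fun u => u :\ i)%SET) /=; last first.
  by move=> u /andP[_]; rewrite negbK; exact: finset.setD1K.
apply: eq_bigl => u; rewrite negbK finset.setU11 andbT.
apply/andP/idP => [[uia /eqP uE]|ua].
  have iu : i \notin u by rewrite -uE !inE eqxx.
  rewrite -(finset.setU1K ia) finset.subsetD1 iu andbT.
  exact: fintype.subset_trans (finset.subsetUr _ _) uia.
rewrite finset.setUS//; split=> //; apply/eqP/finset.setU1K.
by apply: contra ia; apply: (fintype.subsetP ua).
Qed.

(** Adding or removing a fixed element of a nonempty [A] pairs its subsets with opposite signs. *)
Lemma sum_sign_subset A :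
  \sum_(u : {set 'I_n} | u \subset A) (-1) ^+ #|u| = (A == finset.set0)%:R :> R.
Proof.
case: eqP => [->|/eqP/finset.set0Pn[i iA]].
  rewrite (big_pred1 finset.set0) => [|u]; last by rewrite finset.subset0.
  by rewrite finset.cards0.
rewrite -(finset.setD1K iA) sum_subset_setU1 ?inE ?eqxx// -big_split big1//=.
move=> u; rewrite finset.subsetD1 => /andP[_ iu].
by rewrite finset.cardsU1 iu exprS mulN1r subrr.
Qed.

(** Removing [B] turns the interval into the subsets of [C :\: B], where the previous cancellation
    applies. *)
Lemma sum_sign_interval B C : B \subset C ->
  \sum_(A : {set 'I_n} | (B \subset A) && (A \subset C)) (-1) ^+ #|A :\: B|%SET =
    (B == C)%:R :> R.
Proof.
move=> BC.
rewrite (reindex_onto (fun u => B :|: u)%SET (fun A => A :\: B)%SET) /=; last first.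
  move=> A /andP[BA _]; apply/finset.setP => i; rewrite !inE.
  by case: (boolP (i \in B)) => //= /(fintype.subsetP BA) ->.
rewrite (eq_bigl (fun u => u \subset C :\: B)%SET); last first.
  move=> u; rewrite finset.subsetUl/= finset.subUset BC/= finset.subsetD.
  congr (_ && _); rewrite finset.setDUl finset.setDv finset.set0U.
  by rewrite finset.setDE finset.disjoints_subset; apply/eqP/finset.setIidPl.
under eq_bigr => u.
  rewrite finset.subsetD => /andP[_ uB].
  rewrite finset.setDUl finset.setDv finset.set0U (finset.setDidPl uB). over.
rewrite sum_sign_subset finset.setD_eq0 eq_sym; congr (_%:R).
by rewrite finset.eqEsubset BC; case: (C \subset B).
Qed.

(** When [g u] is the squared norm of $E^u Y$ and [A] is nonempty, this is the expectation of $Var^A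
    Y$. *)
Definition alt_sum g A : R :=
  \sum_(u : {set 'I_n} | u \subset A) (-1) ^+ #|u| * g u.

(* Squared norm of the component of the Hoeffding decomposition indexed by [A],
   when [g a] is the squared norm of the conditional expectation off [a]. *)
Definition hoeffding g A : R := alt_sum (fun u => g (u :|: ~: A)%SET) A.

(** Substituting $u = A \setminus B$ exhibits [hoeffding g] as the Moebius transform of $B \mapsto
    g(B^c)$. *)
Lemma hoeffdingE g A : hoeffding g A =
  \sum_(B : {set 'I_n} | B \subset A) (-1) ^+ #|A :\: B|%SET * g (~: B)%SET.
Proof.
rewrite /hoeffding /alt_sum.
rewrite (reindex_onto (fun B => A :\: B)%SET (fun u => A :\: u)%SET) /=; last first.
  move=> u uA; apply/finset.setP => i; rewrite !inE.
  case: (boolP (i \in u)) => /=; first by move=> /(fintype.subsetP uA) ->.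
  by move=> _; case: (i \in A).
apply: eq_big => [B|B].
  rewrite finset.subsetDl/=; apply/eqP/idP => [<-|BA]; first exact: finset.subsetDl.
  apply/finset.setP => i; rewrite !inE.
  case: (boolP (i \in B)) => /=; first by move=> /(fintype.subsetP BA) ->.
  by move=> _; case: (i \in A).
move=> /andP[_ /eqP BA]; congr (_ * g _); apply/finset.setP => i.
by rewrite -[in RHS]BA !inE; case: (i \in A); case: (i \in B).
Qed.

(** After exchanging the sums, each [B] is weighted by a signed sum over the interval from [B] to
    [C], which vanishes unless [B] equals [C]. *)
Lemma moebius g C :
  g (~: C)%SET = \sum_(A : {set 'I_n} | A \subset C) hoeffding g A.
Proof.
under eq_bigr do rewrite hoeffdingE.
rewrite (exchange_big_dep (fun B : {set 'I_n} => B \subset C)) /=; last first.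
  by move=> A B subAC BA; exact: fintype.subset_trans BA subAC.
under eq_bigr => B BC.
  rewrite -big_distrl/= (eq_bigl (fun A => (B \subset A) && (A \subset C))); last first.
    by move=> A; rewrite andbC.
  rewrite sum_sign_interval//. over.
rewrite (bigD1 C)//= eqxx mul1r big1 ?addr0// => B /andP[_ /negbTE ->].
by rewrite mul0r.
Qed.

(** Expanding [g u] by inversion at the complement of [u], the component [A] occurs exactly for $u
    \subset s \setminus A$, and these signs cancel unless [s] lies in [A]. *)
Lemma alt_sumE g s :
  alt_sum g s = \sum_(A : {set 'I_n} | s \subset A) hoeffding g A.
Proof.
rewrite /alt_sum; under eq_bigr do rewrite -[X in g X]finset.setCK moebius big_distrr.
rewrite (exchange_big_dep predT) //= [RHS]big_mkcond/=; apply: eq_bigr => A _.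
rewrite -big_distrl/= (eq_bigl (fun u => u \subset s :\: A)%SET); last first.
  move=> u; rewrite finset.subsetD; congr (_ && _).
  by rewrite disjoint_sym finset.disjoints_subset.
rewrite sum_sign_subset finset.setD_eq0.
by case: (s \subset A); rewrite ?mul1r ?mul0r.
Qed.

(** The component [A] is counted once for each of its subsets of size [k]. *)
Lemma sum_alt_sum_card g k :
  \sum_(s : {set 'I_n} | #|s| == k) alt_sum g s =
  \sum_(A : {set 'I_n}) 'C(#|A|, k)%:R * hoeffding g A.
Proof.
under eq_bigr do rewrite alt_sumE.
rewrite (exchange_big_dep predT)//=; apply: eq_bigr => A _.
rewrite sumr_const -[LHS]mulr_natl -cards_draws; congr (_%:R * _).
by rewrite cardsE; apply: eq_card => s; rewrite !unfold_in /= andbC.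
Qed.

(** Each set of size [k] has [k]! orderings; this factor cancels the normalisation in [J'] and
    [K']. *)
Lemma sum_uniq_tuple F k :
  \sum_(t : k.-tuple 'I_n | uniq t) F [set i in t]%SET =
  k`!%:R * \sum_(s : {set 'I_n} | #|s| == k) F s.
Proof.
rewrite (partition_big (fun t : k.-tuple 'I_n => [set i in t]%SET)
  (fun s => #|s| == k)) /=; last first.
  by move=> t /card_uniqP ut; rewrite cardsE ut size_tuple.
rewrite big_distrr /=; apply: eq_bigr => s /eqP sk.
under eq_bigr => t /andP[_ /eqP ->] do over.
rewrite sumr_const -[LHS]mulr_natl; congr (_%:R * _).
have -> : k`! = #|[set t : k.-tuple 'I_n | all [in s] t & uniq t]%SET|.
  by rewrite card_uniq_tuples sk ffactnn.
rewrite cardsE; apply: eq_card => t; rewrite !unfold_in /= andbC.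
case ut: (uniq t); rewrite ?andbF// !andbT.
apply/eqP/allP => [<- i|ts]; first by rewrite inE.
apply/eqP; rewrite finset.eqEcard sk cardsE (card_uniqP ut) size_tuple leqnn andbT.
by apply/fintype.subsetP => i; rewrite inE; exact: ts.
Qed.

End subset_sums.

(** * Conditional expectation *)

Section condexp_theory.
Context {d : measure_display} {T : measurableType d} {R : realType}.
Variable P : probability T R.
Variable Gen : set (set T).
Hypothesis GenM : <<s Gen >> `<=` measurable.
Local Notation TG := (g_sigma_algebraType Gen).
Local Notation L1 f := (P.-integrable setT (EFin \o f)).

Lemma measurable_fun_sub_sigma (f : T -> R) :
  @measurable_fun _ _ TG R setT f -> measurable_fun setT f.
Proof. by move=> mf _ B mB; apply: GenM; exact: mf. Qed.

Import HBNNSimple.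

(** By linearity [D] is orthogonal to simple functions over the sub-sigma-algebra. These increase to
    [W], and $|DW|$ dominates the products. *)
Lemma ge0_integral_ortho (D W : T -> R) : L1 D ->
  (forall A, <<s Gen >> A -> (\int[P]_(w in A) (D w)%:E = 0)%E) ->
  @measurable_fun _ _ TG R setT W -> (forall w, 0 <= W w) ->
  L1 (fun w => D w * W w) -> (\int[P]_w (D w * W w)%:E = 0)%E.
Proof.
move=> iD D0 mW W0 iDW.
pose WE : TG -> \bar R := EFin \o (W : TG -> R).
have mWE : measurable_fun [set: TG] WE.
  exact/measurable_EFinP.
pose h := nnsfun_approx measurableT mWE.
have hM n y : <<s Gen >> (h n @^-1` [set y]).
  by rewrite -[X in <<s _ >> X]setTI; exact: (@measurable_funP _ _ _ _ _ (h n)).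
have iDM A : <<s Gen >> A -> L1 (fun w => D w * \1_A w).
  move=> GA; have mA := GenM GA.
  rewrite (_ : _ \o _ = (EFin \o D) \_ A); last first.
    apply/funext => w; rewrite /= patchE indicE /=.
    by case: ifPn => _; rewrite ?mulr1 ?mulr0.
  apply: (proj1 (integrable_mkcond (EFin \o D) mA)).
  exact: (integrableS measurableT).
have h0 n : (\int[P]_w (D w * h n w)%:E = 0)%E.
  have hE w : (D w * h n w)%:E =
      (\sum_(y <- finmap.enum_fset (fset_set (range (h n))))
      (y%:E * (D w * \1_(h n @^-1` [set y]) w)%:E))%E.
    rewrite fimfunE fsbig_finite//= mulr_sumr -sumEFin; apply: eq_bigr => y _.
    by rewrite mulrCA EFinM.
  under eq_integral do rewrite hE.
  rewrite integral_sum//; last first.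
    by move=> i; apply: integrableZl => //; exact: iDM.
  rewrite big1// => i _; rewrite integralZl//; last exact: iDM.
  set A := h n @^-1` _.
  have -> : (\int[P]_w (D w * \1_A w)%:E = \int[P]_(w in A) (D w)%:E)%E.
    rewrite [RHS]integral_mkcond; apply: eq_integral => w _.
    by rewrite patchE indicE; case: ifPn => _; rewrite ?mulr1 ?mulr0.
  by rewrite D0 ?mule0//; exact: hM.
have [] := @dominated_convergence _ _ _ P setT measurableT
   (fun n w => (D w * h n w)%:E) (fun w => (D w * W w)%:E)
   (fun w => `|D w * W w|%:E).
- move=> n; apply/measurable_EFinP/measurable_funM.
    exact/measurable_EFinP/(measurable_int P iD).
  by apply: measurable_fun_sub_sigma; exact: (@measurable_funP _ _ _ _ _ (h n)).
- exact: measurable_int iDW.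
- apply: aeW => w _; under eq_fun do rewrite EFinM.
  rewrite EFinM; apply: cvgeZl => //.
  by apply: (cvg_nnsfun_approx measurableT mWE) => // x _; rewrite /WE /= lee_fin.
- exact: (integrable_abse iDW).
- apply: aeW => w n _; rewrite abse_EFin lee_fin !normrM ler_wpM2l//.
  rewrite !ger0_norm// -lee_fin.
  by rewrite nnsfun_approxE le_approx// => x _; rewrite /WE /= lee_fin.
- move=> _ _ /cvg_lim <- //; rewrite (_ : [sequence _]_n = cst 0%E).
    exact: lim_cst.
  by apply/funext => n /=; rewrite h0.
Qed.

(** A version is the Radon-Nikodym density of the charge $A \mapsto \int_A Y dP$ with respect to
    [P], both restricted to the sub-sigma-algebra. *)
Lemma condexp_exists (Y : T -> R) : L1 Y ->
  exists Z, is_condexp P <<s Gen >> Y Z.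
Proof.
move=> iY.
have mid : measurable_fun setT (id : T -> TG).
  by move=> _ B mB; rewrite setTI; apply: GenM.
(* The restriction of [P] is encoded as its image under the identity into the coarser space, so
   integrals transfer by change of variables. *)
pose phi : {mfun T >-> TG} := HB.pack_for {mfun T >-> TG} (id : T -> TG)
   (isMeasurableFun.Build _ _ _ _ _ mid).
pose PG : probability TG R := distribution P phi.
pose nu0 : {charge set T -> \bar R} := induced_charge iY.
pose nu : set TG -> \bar R := fun A => nu0 A.
have nuE A : nu A = (\int[P]_(w in A) (Y w)%:E)%E by [].
have nu_0 : nu set0 = 0%E by exact: charge0.
have nu_fin A : measurable A -> nu A \is a fin_num.
  by move=> mA; apply: fin_num_measure; exact: GenM.
have nu_sig : semi_sigma_additive nu.
  move=> F mF tF mUF; apply: charge_semi_sigma_additive => //.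
    by move=> i; apply: GenM; exact: mF.
  exact: GenM.
pose nuC : {charge set TG -> \bar R} := HB.pack_for (@Charge.type _ TG R) nu
  (isCharge.Build _ _ _ nu nu_0 nu_fin nu_sig).
have dom : nuC `<< PG.
  apply/null_content_dominatesP => A mA PA.
  rewrite -[nuC A]/(\int[P]_(w in A) (Y w)%:E)%E; apply: null_set_integral => //.
    exact: GenM.
  by apply: measurable_funTS; exact: measurable_int iY.
pose f := Radon_Nikodym nuC PG.
have fi : PG.-integrable setT f by exact: Radon_Nikodym_integrable.
have ff x : f x \is a fin_num by exact: Radon_Nikodym_fin_num.
exists (fine \o f : T -> R).
have fE : EFin \o (fine \o f) = f by apply/funext => x /=; rewrite fineK.
have mf : measurable_fun (setT : set TG) (fine \o f).
  by apply/measurable_EFinP; rewrite fE; exact: measurable_int fi.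
have PfE : P.-integrable setT (EFin \o (fine \o f : T -> R)).
  rewrite fE; apply/integrableP; split.
    apply: (measurableT_comp (measurable_int _ fi) mid).
  have /integrableP[_] := fi.
  rewrite ge0_integral_pushforward//.
  apply: measurableT_comp => //; exact: measurable_int fi.
split => //.
  by move=> B mB; rewrite -[X in <<s _ >> X]setTI; exact: mf.
move=> A GA; under eq_integral => x _ do rewrite (fineK (ff x)).
rewrite -nuE -[nu A]/(nuC A) (Radon_Nikodym_integral dom GA).
rewrite (integral_pushforward (phi := (id : T -> TG)))//.
by rewrite fE in PfE; apply: (@integrableS _ _ _ _ setT) => //; exact: GenM.
Qed.
End condexp_theory.

(** * Conditional expectation of square-integrable functions *)

Section condexp_L2.
Context {d : measure_display} {T : measurableType d} {R : realType}.
Variable P : probability T R.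
Local Notation L1 f := (P.-integrable setT (EFin \o f)).
Local Notation L2 f := (f \in Lfun P 2%:E).

Lemma Lfun2_integrable (f : T -> R) : L2 f -> L1 f.
Proof.
move=> f2; apply/Lfun1_integrable/(Lfun_subset12 _ f2).
by rewrite fin_num_measure.
Qed.

Lemma Lfun2_integrableM (f g : T -> R) : L2 f -> L2 g ->
  L1 (fun w => f w * g w).
Proof. by move=> f2 g2; apply/Lfun1_integrable; exact: Lfun2_mul_Lfun1. Qed.

Lemma sqr_integrable_Lfun2 (f : T -> R) : measurable_fun setT f ->
  (\int[P]_w (f w ^+ 2)%:E < +oo)%E -> L2 f.
Proof.
move=> mf f2; rewrite inE; apply/andP; split; rewrite inE//=.
rewrite /finite_norm unlock /= poweR_lty//.
under eq_integral do rewrite powR_mulrn// real_normK ?num_real//.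
done.
Qed.

Lemma Lfun2B (f g : T -> R) : L2 f -> L2 g -> L2 (fun w => f w - g w).
Proof.
move=> f2 g2; have [_ Lf] := @Lfun_submod_closed _ T R P _ (lee1n 2).
rewrite (_ : (fun w => _) = -1 *: g + f); first exact: Lf.
by apply/funext => w; rewrite /= scaleN1r addrC.
Qed.

Section sub_sigma.
Variable Gen : set (set T).
Hypothesis GenM : <<s Gen >> `<=` measurable.
Local Notation TG := (g_sigma_algebraType Gen).
Local Notation Gmeas f := (@measurable_fun _ _ TG R setT f).

Lemma sub_sigma_measurableP (f : T -> R) :
  (forall B : set R, measurable B -> <<s Gen >> (f @^-1` B)) <-> Gmeas f.
Proof.
split => [mf _ B mB|mf B mB]; first by rewrite setTI; exact: mf.
by rewrite -[X in <<s _ >> X]setTI; exact: mf.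
Qed.

(** The positive and negative parts of [W] are bounded by $|W|$, so their products with [D] stay
    integrable and the nonnegative case applies to each. *)
Lemma integral_ortho (D W : T -> R) : L1 D ->
  (forall A, <<s Gen >> A -> (\int[P]_(w in A) (D w)%:E = 0)%E) ->
  Gmeas W -> L1 (fun w => D w * W w) -> (\int[P]_w (D w * W w)%:E = 0)%E.
Proof.
move=> iD D0 mW iDW.
have mD : measurable_fun setT D by exact/measurable_EFinP/(measurable_int P iD).
have le_DW f : Gmeas f -> (forall w, `|f w| <= `|W w|) ->
    L1 (fun w => D w * f w).
  move=> /(measurable_fun_sub_sigma GenM) mf fW.
  apply: (le_integrable _ _ _ iDW) => //.
    exact/measurable_EFinP/measurable_funM.
  by move=> w _; rewrite /= lee_fin !normrM ler_wpM2l.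
have iDp : L1 (fun w => D w * W^\+ w).
  apply: le_DW; first exact: measurable_funrpos.
  move=> w; rewrite -[leRHS]/((Num.norm \o W) w) -funrposDneg.
  by rewrite ger0_norm// lerDl.
have iDn : L1 (fun w => D w * W^\- w).
  apply: le_DW; first exact: measurable_funrneg.
  move=> w; rewrite -[leRHS]/((Num.norm \o W) w) -funrposDneg.
  by rewrite ger0_norm// lerDr.
rewrite (_ : (fun w => _) = fun w => (D w * W^\+ w)%:E - (D w * W^\- w)%:E)%E;
  last by apply/funext => w; rewrite -EFinB -mulrBr -{1}(funrposBneg W).
rewrite integralB_EFin// !(ge0_integral_ortho GenM)// ?subee//.
- exact: measurable_funrneg.
- exact: measurable_funrpos.
Qed.

Lemma condexp_is (Y : T -> R) : L1 Y ->
  is_condexp P <<s Gen >> Y (condexp P <<s Gen >> Y).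
Proof.
by move=> /(condexp_exists GenM) YZ; exact: (xgetPex (cst 0) YZ).
Qed.

Section version.
Variables Y Z : T -> R.
Hypothesis YZ : is_condexp P <<s Gen >> Y Z.

Lemma is_condexp_Gmeas : Gmeas Z.
Proof. by have [/sub_sigma_measurableP] := YZ. Qed.

Lemma is_condexp_integrable : L1 Z. Proof. by case: YZ. Qed.

Lemma is_condexp_int0 : L1 Y -> forall A, <<s Gen >> A ->
  (\int[P]_(w in A) (Y w - Z w)%:E = 0)%E.
Proof.
move=> iY A GA; have [_ iZ] := YZ; move=> /(_ A GA) YZA.
have mA := GenM GA.
have iYA : P.-integrable A (EFin \o Y) by exact: (@integrableS _ _ _ _ setT).
have iZA : P.-integrable A (EFin \o Z) by exact: (@integrableS _ _ _ _ setT).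
rewrite integralB_EFin// YZA subee//.
exact: (integrable_fin_num mA iYA).
Qed.

(** Orthogonality cannot be tested against [Z] before $Z^2$ is known to be integrable, so [Z] is
    truncated where $|Z| \le m$. The truncations have second moment at most that of [Y], and
    monotone convergence concludes. *)
Lemma is_condexp_Lfun2 : L2 Y -> L2 Z.
Proof.
move=> Y2; have iY := Lfun2_integrable Y2.
have mZ := measurable_fun_sub_sigma GenM is_condexp_Gmeas.
pose A m : set T := [set w | `|Z w| <= m%:R].
have GA m : <<s Gen >> (A m).
  rewrite (_ : A m = Z @^-1` `[- m%:R, m%:R]); last first.
    by apply/seteqP; split=> w; rewrite /A/= in_itv/= ler_norml.
  by have [+ _ _] := YZ; apply; exact: measurable_itv.
have mA m := GenM (GA m).
have le_int m :
    (\int[P]_(w in A m) (Z w ^+ 2)%:E <= \int[P]_w (Y w ^+ 2)%:E)%E.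
  pose W w := Z w * \1_(A m) w.
  have WE w : W w ^+ 2 = ((fun w => Z w ^+ 2) \_ (A m)) w.
    by rewrite /W patchE indicE; case: ifPn => _; rewrite ?mulr1// mulr0 expr0n.
  have ZW w : Z w * W w = W w ^+ 2.
    rewrite /W exprMn mulrA -expr2 indicE.
    by case: (_ \in _); rewrite ?mulr0 ?expr0n ?mulr0// expr1n.
  have mW : Gmeas W.
    apply: measurable_funM; first exact: is_condexp_Gmeas.
    exact: (@measurable_indic _ TG R setT (A m) (GA m)).
  have W2 : L2 W.
    apply: sqr_integrable_Lfun2; first exact: measurable_fun_sub_sigma mW.
    apply: (@le_lt_trans _ _ (\int[P]_w ((m%:R ^+ 2) : R)%:E)%E); last first.
      by rewrite integral_cst//= probability_setT mule1 ltry.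

    apply: ge0_le_integral => //=.
    - by move=> w _; rewrite lee_fin sqr_ge0.
    - apply/measurable_EFinP/measurable_funX.
      exact: measurable_fun_sub_sigma mW.
    - move=> w _; rewrite lee_fin WE patchE; case: ifPn; last by rewrite sqr_ge0.
      by rewrite inE /A /= -real_normK ?num_real// ler_sqr ?nnegrE.
  have iYW := Lfun2_integrableM Y2 W2.
  have iWW : L1 (fun w => W w ^+ 2) by exact: Lfun2_integrable_sqr.
  have iYY : L1 (fun w => Y w ^+ 2) by exact: Lfun2_integrable_sqr.
  have YWE : \int[P]_w (Y w * W w) = \int[P]_w (W w ^+ 2).
    apply/eqP; rewrite -subr_eq0 -RintegralB//; apply/eqP.
    have YW w : Y w * W w - W w ^+ 2 = (Y w - Z w) * W w.
      by rewrite mulrBl ZW.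
    under eq_Rintegral do rewrite YW.
    rewrite /Rintegral (integral_ortho _ (is_condexp_int0 iY))//.
      exact: (integrableB measurableT iY is_condexp_integrable).
    rewrite (_ : _ \o _ = (fun w => (Y w * W w)%:E - (W w ^+ 2)%:E)%E).
      exact: integrableB.
    by apply/funext => w; rewrite /= -YW.
  (* Integrating $(Y - W)^2 \ge 0$; with $E(YW) = E(W^2)$ this leaves $E(W^2) \le E(Y^2)$. *)
  have le2 : \int[P]_w (Y w * W w) *+ 2 <=
      \int[P]_w (Y w ^+ 2) + \int[P]_w (W w ^+ 2).
    rewrite -RintegralD// -mulr_natr -RintegralZr//; apply: le_Rintegral => //.
    - exact: (integrableZr measurableT 2%R iYW).
    - exact: (integrableD measurableT iYY iWW).
    - move=> w _; rewrite -subr_ge0.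
      by rewrite (_ : _ - _ = (Y w - W w) ^+ 2) ?sqr_ge0//; ring.
  have : \int[P]_w (W w ^+ 2) <= \int[P]_w (Y w ^+ 2) by lra.
  rewrite -lee_fin /Rintegral !fineK; [|exact: integrable_fin_num..].
  rewrite [X in _ -> (X <= _)%E]integral_mkcond.
  rewrite (_ : _ \_ _ = fun w => (W w ^+ 2)%:E)//.
  by apply/funext => w; rewrite WE !patchE; case: ifPn.
apply: sqr_integrable_Lfun2 => //.
have AT : \bigcup_m A m = setT.
  rewrite -subTset => w _; exists (Num.truncn `|Z w|).+1 => //.
  by rewrite /A/= ltW// truncnS_gt.
have ndA : nondecreasing_seq A.
  move=> i j ij; apply/subsetPset => w; rewrite /A/= => /le_trans; apply.
  by rewrite ler_nat.
have cvgA : (\int[P]_(w in A m) (Z w ^+ 2)%:E)%E @[m --> \oo] -->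
    (\int[P]_w (Z w ^+ 2)%:E)%E.
  rewrite -[in X in _ --> X]AT; apply: ge0_nondecreasing_set_cvg_integral => //.
  - move=> i; apply/measurable_EFinP/measurable_funX.
    exact: measurable_funTS.
  - by move=> *; rewrite lee_fin sqr_ge0.
apply: (@le_lt_trans _ _ (\int[P]_w (Y w ^+ 2)%:E)%E); last first.
  have /integrableP[_] := Lfun2_integrable_sqr Y2.
  by under eq_integral do rewrite /= ger0_norm ?sqr_ge0//.
rewrite -(cvg_lim _ cvgA)//; apply: lime_le; last exact: nearW.
by apply/cvg_ex; eexists; exact: cvgA.
Qed.

Lemma is_condexp_ortho (W : T -> R) : L2 Y -> Gmeas W -> L2 W ->
  \int[P]_w (Y w * W w) = \int[P]_w (Z w * W w).
Proof.
move=> Y2 mW W2; have Z2 := is_condexp_Lfun2 Y2.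
have iYW := Lfun2_integrableM Y2 W2; have iZW := Lfun2_integrableM Z2 W2.
apply/eqP; rewrite -subr_eq0 -RintegralB//; apply/eqP.
under eq_Rintegral do rewrite -mulrBl.
have iY := Lfun2_integrable Y2; have iZ := Lfun2_integrable Z2.
rewrite /Rintegral (integral_ortho _ (is_condexp_int0 iY))//.
  exact: (integrableB measurableT iY iZ).
rewrite (_ : _ \o _ = (fun w => (Y w * W w)%:E - (Z w * W w)%:E)%E).
  exact: integrableB.
by apply/funext => w; rewrite /= mulrBl EFinB.
Qed.

End version.

(** The difference $Z_1 - Z_2$ is itself an admissible test function: pairing it with either version
    gives its pairing with [Y], so its squared norm is zero. *)
Lemma is_condexp_unique (Y Z1 Z2 : T -> R) : L2 Y ->
  is_condexp P <<s Gen >> Y Z1 -> is_condexp P <<s Gen >> Y Z2 ->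
  ae_eq P setT Z1 Z2.
Proof.
move=> Y2 YZ1 YZ2.
have Z12 := is_condexp_Lfun2 YZ1 Y2; have Z22 := is_condexp_Lfun2 YZ2 Y2.
have mW : Gmeas (fun w => Z1 w - Z2 w).
  by apply: measurable_funB; [exact: is_condexp_Gmeas YZ1|
                              exact: is_condexp_Gmeas YZ2].
have W2 : L2 (fun w => Z1 w - Z2 w) by exact: Lfun2B.
have W0 : \int[P]_w ((Z1 w - Z2 w) ^+ 2) = 0.
  under eq_Rintegral do rewrite expr2 mulrBl.
  rewrite RintegralB//; [|exact: Lfun2_integrableM..].
  by rewrite -(is_condexp_ortho YZ1)// -(is_condexp_ortho YZ2)// subrr.
have iW2 := Lfun2_integrable_sqr W2.
have /(ae_eq_integral_abs P measurableT) : measurable_fun setT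
   (fun w => ((Z1 w - Z2 w) ^+ 2)%:E) by exact: measurable_int iW2.
move=> [+ _]; have -> : (\int[P]_w `|((Z1 w - Z2 w) ^+ 2)%:E| = 0)%E.
  under eq_integral do rewrite abse_EFin ger0_norm ?sqr_ge0//.
  by rewrite -[LHS]fineK ?(integrable_fin_num _ iW2)//; congr EFin.
move=> /(_ erefl); apply: filterS => w /(_ I) /=.
by move=> [/eqP]; rewrite sqrf_eq0 subr_eq0 => /eqP.
Qed.

(** The equality is strict and not merely almost sure: both sides choose from the same set of
    versions. *)
Lemma eq_condexp (Y Y' : T -> R) : L1 Y -> L1 Y' -> ae_eq P setT Y Y' ->
  condexp P <<s Gen >> Y = condexp P <<s Gen >> Y'.
Proof.
move=> iY iY' YY'; congr (xget _ _); apply/funext => Z; apply/propext.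
have YYA A : <<s Gen >> A ->
    (\int[P]_(w in A) (Y w)%:E = \int[P]_(w in A) (Y' w)%:E)%E.
  move=> /GenM mA; apply: ae_eq_integral => //.
  - by apply: measurable_funTS; exact: measurable_int iY.
  - by apply: measurable_funTS; exact: measurable_int iY'.
  - by apply: filterS YY' => w /(_ I) ->.
by split=> -[mZ iZ YZ]; split=> // A GA; rewrite YZ// YYA.
Qed.

End sub_sigma.
End condexp_L2.

(** * Independence *)

Section independence_theory.
Context {d : measure_display} {T : measurableType d} {R : realType}.
Variable P : probability T R.
Local Notation L1 f := (P.-integrable setT (EFin \o f)).

(** Dynkin's argument: additivity of the charge with density [D] makes the sets of zero integral a
    Dynkin system containing the pi-system [G]. *)
Lemma integral0_sigma (D : T -> R) (G : set (set T)) : L1 D ->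
  setI_closed G -> G `<=` measurable -> G setT ->
  (forall A, G A -> (\int[P]_(w in A) (D w)%:E = 0)%E) ->
  forall A, <<s G >> A -> (\int[P]_(w in A) (D w)%:E = 0)%E.
Proof.
move=> iD GI GM GT G0 A.
pose H := [set A | measurable A /\ (\int[P]_(w in A) (D w)%:E = 0)%E].
suff: <<s G >> `<=` H by move=> /[apply] -[].
rewrite -setI_closed_g_dynkin_g_sigma_algebra//.
apply: smallest_sub; last by move=> B GB; split; [exact: GM|exact: G0].
pose nu : {charge set T -> \bar R} := induced_charge iD.
have nuE B : nu B = (\int[P]_(w in B) (D w)%:E)%E by [].
have nuT : nu setT = 0%E by rewrite nuE G0.
split.
- by split.
- move=> B [mB B0]; split; first exact: measurableC.
  have : nu (B `|` ~` B) = (nu B + nu (~` B))%E.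
    apply: chargeU => //; first exact: measurableC.
    exact: setICr.
  by rewrite setUv nuT !nuE B0 add0e => <-.
- move=> F tF HF; split; first by apply: bigcup_measurable => k _; case: (HF k).
  have mF k : measurable (F k) by case: (HF k).
  have mUF : measurable (\bigcup_k F k) by apply: bigcup_measurable => k _.
  have /cvg_lim nuF := @charge_semi_sigma_additive _ _ _ nu F mF tF mUF.
  rewrite -nuE -nuF//.
  rewrite (_ : (fun _ => _) = cst 0%E); first exact: lim_cst.
  by apply/funext => k; rewrite big1// => i _; rewrite nuE; case: (HF i).
Qed.

(** Its integral over [A] is $P(A \cap C) - P(A) P(C)$, so independence of [A] and [C] becomes a
    vanishing integral, to which [integral0_sigma] applies. *)
Let centered C w : R := \1_C w - fine (P C).

Let iC C : measurable C -> L1 (centered C).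
Proof.
move=> mC.
rewrite (_ : _ \o _ = (fun w => (\1_C w)%:E - (EFin \o cst (fine (P C))) w)%E).
  apply: integrableB => //; first exact: integrable_indic.
  exact: finite_measure_integrable_cst.
by apply/funext.
Qed.

Let centered_int C A : measurable C -> measurable A ->
  (\int[P]_(w in A) (centered C w)%:E = P (A `&` C) - P A * P C)%E.
Proof.
move=> mC mA; rewrite integralB_EFin//; last first.
- exact: finite_measure_integrable_cst.
- by apply: (@integrableS _ _ _ _ setT) => //; exact: integrable_indic.
rewrite integral_indic// setIC integral_cst// fineK ?fin_num_measure//.
by rewrite muleC.
Qed.

(** One factor is extended at a time: first [G1] with [C] fixed in [G2], then [G2] with [A] fixed in
    the sigma-algebra of [G1]. *)
Lemma indep_sigma (G1 G2 : set (set T)) :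
  setI_closed G1 -> G1 `<=` measurable -> G1 setT ->
  setI_closed G2 -> G2 `<=` measurable -> G2 setT ->
  (forall A C, G1 A -> G2 C -> (P (A `&` C) = P A * P C)%E) ->
  forall A C, <<s G1 >> A -> <<s G2 >> C -> (P (A `&` C) = P A * P C)%E.
Proof.
move=> I1 M1 T1 I2 M2 T2 G12.
have S1 : <<s G1 >> `<=` measurable.
  by apply: smallest_sub => //; exact: sigma_algebra_measurable.
have S2 : <<s G2 >> `<=` measurable.
  by apply: smallest_sub => //; exact: sigma_algebra_measurable.
have c0 C A : measurable C -> measurable A ->
    (\int[P]_(w in A) (centered C w)%:E = 0)%E <-> (P (A `&` C) = P A * P C)%E.
  move=> mC mA; rewrite centered_int//; split=> [/eqP|->].
    by rewrite sube_eq ?add0e ?fin_num_adde_defl ?fin_numM ?fin_num_measure//;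
      [move=> /eqP|exact: measurableI].
  by rewrite subee// fin_numM ?fin_num_measure.
have step1 A C : <<s G1 >> A -> G2 C -> (P (A `&` C) = P A * P C)%E.
  move=> GA GC; apply/c0; [exact: M2|exact: S1|].
  apply: (integral0_sigma (iC (M2 _ GC)) I1) => // B GB.
  by apply/c0; [exact: M2|exact: M1|exact: G12].
move=> A C GA GC; rewrite setIC muleC; apply/c0; [exact: S1|exact: S2|].
apply: (integral0_sigma (iC (S1 _ GA)) I2) => // B GB.
by apply/c0; [exact: S1|exact: M2|rewrite setIC muleC step1].
Qed.

(** Independence makes [centered C] orthogonal to every set of the sigma-algebra, hence to [U]. *)
Lemma indep_integral (Gen : set (set T)) (U : T -> R) (C : set T) :
  <<s Gen >> `<=` measurable -> measurable C ->
  (forall A, <<s Gen >> A -> (P (A `&` C) = P A * P C)%E) ->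
  @measurable_fun _ _ (g_sigma_algebraType Gen) R setT U -> L1 U ->
  \int[P]_(w in C) U w = fine (P C) * \int[P]_w U w.
Proof.
move=> GM mC indC mU iU.
have iUC : L1 (fun w => U w * \1_C w).
  rewrite (_ : _ \o _ = (EFin \o U) \_ C); last first.
    apply/funext => w; rewrite /= patchE indicE /=.
    by case: ifPn => _; rewrite ?mulr1 ?mulr0.
  apply: (proj1 (integrable_mkcond (EFin \o U) mC)).
  exact: (integrableS measurableT).
have iUc : L1 (fun w => fine (P C) * U w).
  exact: (integrableZl measurableT (fine (P C)) iU).
have : \int[P]_w (centered C w * U w) = 0.
  rewrite /Rintegral (integral_ortho GM (iC mC))//.
  - move=> A GA; rewrite centered_int//; last exact: GM.
    by rewrite indC// subee// fin_numM ?fin_num_measure//; exact: GM.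
  - rewrite (_ : _ \o _ = fun w => (U w * \1_C w)%:E - (fine (P C) * U w)%:E)%E.
      exact: integrableB.
    by apply/funext => w; rewrite /= mulrBl [\1_C w * _]mulrC EFinB.
under eq_Rintegral do rewrite mulrBl [\1_C _ * _]mulrC.
rewrite RintegralB// RintegralZl// => /eqP; rewrite subr_eq0 => /eqP <-.
rewrite Rintegral_mkcond; apply: eq_Rintegral => w _.
by rewrite patchE indicE; case: ifPn => _; rewrite ?mulr1 ?mulr0.
Qed.

End independence_theory.

(** * Conditional expectations off sets of coordinates *)

Section coordinate_condexp.
Context {d : measure_display} {T : measurableType d} {R : realType}.
Variable P : probability T R.
Variables (n : nat) (X : 'I_n -> {RV P >-> R}).
Local Notation L1 f := (P.-integrable setT (EFin \o f)).
Local Notation L2 f := (f \in Lfun P 2%:E).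
Implicit Types a b : {set 'I_n}.

(* [sigma_off X a] is convertible to [<<s gen_off a >>]. *)
Definition gen_off a : set (set T) :=
  \bigcup_(j in [set j | j \notin a]) preimage_set_system setT (X j) measurable.

(** Finite intersections are built in so that this generator of [sigma_off X a] is a pi-system. *)
Definition cylinder_off a : set (set T) :=
  [set \bigcap_(i in [set i | i \notin a]) (X i @^-1` B i) |
     B in [set B : 'I_n -> set R | forall i, measurable (B i)]].

Lemma cylinder_off_setI a : setI_closed (cylinder_off a).
Proof.
move=> _ _ [B mB <-] [C mC <-]; exists (fun i => B i `&` C i) => /=.
  by move=> i; exact: measurableI.
by rewrite -bigcapI.
Qed.

Lemma cylinder_off_setT a : cylinder_off a setT.
Proof.
by exists (fun=> setT) => //; apply/seteqP; split.
Qed.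

Lemma cylinder_off_measurable a : cylinder_off a `<=` measurable.
Proof.
move=> _ [B mB <-]; apply: fin_bigcap_measurable => // i _.
exact: measurable_funPTI.
Qed.

Lemma sigma_off_measurable a : sigma_off X a `<=` measurable.
Proof.
apply: smallest_sub; first exact: sigma_algebra_measurable.
by move=> _ [i _ [B mB <-]]; rewrite setTI; exact: measurable_funPTI.
Qed.

Lemma cylinder_sigma_off a : cylinder_off a `<=` sigma_off X a.
Proof.
move=> _ [B mB <-].
apply: (@fin_bigcap_measurable _ (g_sigma_algebraType (gen_off a))) => // i ia.
by apply: sub_sigma_algebra; exists i => //; exists (B i) => //; rewrite setTI.
Qed.

Lemma sigma_offE a : sigma_off X a = <<s cylinder_off a >>.
Proof.
apply/seteqP; split; apply: smallest_sub;
  [exact: smallest_sigma_algebra| |exact: smallest_sigma_algebra|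
   exact: cylinder_sigma_off].
move=> _ [i ia [B mB <-]]; apply: sub_sigma_algebra.
exists (fun j => if j == i then B else setT) => /=.
  by move=> j; case: ifP.
rewrite setTI; apply/seteqP; split=> w /=.
  by move=> /(_ i ia); rewrite eqxx.
by move=> wB j _; case: eqP => [->|].
Qed.

Lemma sigma_offS a b : a \subset b -> sigma_off X b `<=` sigma_off X a.
Proof.
move=> /fintype.subsetP ab; apply: smallest_sub.
  exact: smallest_sigma_algebra.
move=> _ [i ib [B mB <-]]; apply: sub_sigma_algebra; exists i => //=.
  by apply: contra ib => /ab.
by exists B.
Qed.

Hypothesis indX : mutually_independent X.

(** The hypothesis says that no coordinate lies off both [a] and [b], so on cylinders the claim is
    mutual independence over disjoint index sets. *)
Lemma sigma_off_indep a b A C : a :|: b = finset.setT ->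
  sigma_off X a A -> sigma_off X b C -> (P (A `&` C) = P A * P C)%E.
Proof.
move=> abT; rewrite !sigma_offE; apply: indep_sigma;
  do ?[exact: cylinder_off_setI|exact: cylinder_off_setT|
       exact: cylinder_off_measurable].
move=> _ _ [B mB <-] [B' mB' <-].
(* An index off [a] lies in [b], so a single family can carry [B] off [a] and [B'] off [b]. *)
pose B2 i := if i \in b then B i else B' i.
have bigE (c : {set 'I_n}) (F : 'I_n -> set R) :
    \bigcap_(i in [set i | i \notin c]) X i @^-1` F i =
    \bigcap_(i in [set` finset.setC c]) X i @^-1` F i.
  by congr bigcap; apply/seteqP; split=> i /=; rewrite inE.
have ab i : i \notin a -> i \in b.
  by have := finset.in_setT i; rewrite -abT inE => /orP[->|].
have -> : \bigcap_(i in [set i | i \notin a]) X i @^-1` B i `&`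
    \bigcap_(i in [set i | i \notin b]) X i @^-1` B' i =
    \bigcap_(i in [set` (finset.setC a :|: finset.setC b)%SET]) X i @^-1` B2 i.
  apply/seteqP; split=> w.
    move=> [wB wB'] i /=; rewrite !inE /B2 => /orP[ia|ib].
      by rewrite ab//; exact: wB.
    by rewrite (negbTE ib); exact: wB'.
  move=> wB; split=> i /= ic.
    by have := wB i; rewrite /B2 ab//; apply; rewrite /= !inE ic.
  by have := wB i; rewrite /B2 (negbTE ic); apply; rewrite /= !inE ic orbT.
rewrite !bigE !indX//; last by move=> i; rewrite /B2; case: ifP.
rewrite (big_setID (finset.setC a)) /=; congr (_ * _)%E.
  apply: eq_big => [i|i]; first by rewrite !inE; case: (i \in a); rewrite ?andbF.
  by rewrite !inE => /andP[_ ia]; rewrite /B2 ab.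
apply: eq_big => [i|i].
  by rewrite !inE; case: (boolP (i \in a)) => //= /ab ->.
by rewrite !inE /B2 => /andP[]; rewrite negbK => -> /= /negbTE ->.
Qed.

Section cE_theory.
Implicit Types Y Z : T -> R.

Lemma cE_is_condexp a Y : L2 Y -> is_condexp P (sigma_off X a) Y (cE X a Y).
Proof.
move=> Y2; apply: condexp_is; first exact: sigma_off_measurable.
exact: Lfun2_integrable.
Qed.

Lemma cE_Lfun2 a Y : L2 Y -> L2 (cE X a Y).
Proof.
move=> Y2; apply: (is_condexp_Lfun2 _ (cE_is_condexp a Y2)) => //.
exact: sigma_off_measurable.
Qed.

Lemma cE_unique a Y Z : L2 Y -> is_condexp P (sigma_off X a) Y Z ->
  ae_eq P setT (cE X a Y) Z.
Proof.
move=> Y2 YZ; apply: (is_condexp_unique _ Y2 (cE_is_condexp a Y2) YZ).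
exact: sigma_off_measurable.
Qed.

Lemma eq_cE a Y Z : L2 Y -> L2 Z -> ae_eq P setT Y Z -> cE X a Y = cE X a Z.
Proof.
move=> Y2 Z2 YZ; apply: eq_condexp => //; try exact: Lfun2_integrable.
exact: sigma_off_measurable.
Qed.

Lemma cE_ortho a Y : L2 Y ->
  \int[P]_w (Y w * cE X a Y w) = \int[P]_w (cE X a Y w ^+ 2).
Proof.
move=> Y2; have YE := cE_is_condexp a Y2.
apply: (is_condexp_ortho _ YE) => //; try exact: sigma_off_measurable.
- exact: is_condexp_Gmeas YE.
- exact: cE_Lfun2.
Qed.

Lemma cEB a Y Z : L2 Y -> L2 Z ->
  ae_eq P setT (cE X a (fun w => Y w - Z w)) (fun w => cE X a Y w - cE X a Z w).
Proof.
move=> Y2 Z2; apply: cE_unique; first exact: Lfun2B.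
have YE := cE_is_condexp a Y2; have ZE := cE_is_condexp a Z2.
have iYZ := Lfun2_integrable (Lfun2B (cE_Lfun2 a Y2) (cE_Lfun2 a Z2)).
split=> //.
  apply/sub_sigma_measurableP; apply: measurable_funB.
    exact: is_condexp_Gmeas YE.
  exact: is_condexp_Gmeas ZE.
move=> A GA; have mA := sigma_off_measurable GA.
have iA f : L2 f -> P.-integrable A (EFin \o f).
  by move=> /Lfun2_integrable; apply: integrableS.
rewrite !integralB_EFin//; [|by apply: iA => //; exact: cE_Lfun2..].
by case: YE => _ _ ->//; case: ZE => _ _ ->.
Qed.

Lemma sigma_off_integral_eq a Y Z : L2 Y -> L2 Z ->
  (forall A, cylinder_off a A -> \int[P]_(w in A) (Y w - Z w) = 0) ->
  forall A, sigma_off X a A ->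
    (\int[P]_(w in A) (Y w)%:E = \int[P]_(w in A) (Z w)%:E)%E.
Proof.
move=> Y2 Z2 YZ A GA; have mA := sigma_off_measurable GA.
have iD := Lfun2_integrable (Lfun2B Y2 Z2).
have iA f : L1 f -> P.-integrable A (EFin \o f) by apply: integrableS.
have iYA := iA _ (Lfun2_integrable Y2); have iZA := iA _ (Lfun2_integrable Z2).
rewrite -[LHS](@subeK _ _ (\int[P]_(w in A) (Z w)%:E)%E); last first.
  exact: (integrable_fin_num mA iZA).
rewrite -integralB_EFin//.
rewrite (_ : (\int[P]_(w in A) (Y w - Z w)%:E = 0)%E) ?add0e//.
move: GA; rewrite sigma_offE; apply: (integral0_sigma iD).
- exact: cylinder_off_setI.
- exact: cylinder_off_measurable.
- exact: cylinder_off_setT.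
move=> B cB; have mB := cylinder_off_measurable cB.
have iDB : P.-integrable B (EFin \o (fun w => Y w - Z w)).
  exact: (@integrableS _ _ _ _ setT).
by rewrite -[LHS]fineK ?(integrable_fin_num mB iDB)//; congr EFin; exact: YZ.
Qed.

(* A cylinder off [a] is the intersection of a cylinder off [a :|: b] with a
   cylinder based on the coordinates in [b :\: a]; the latter is independent of
   both conditional expectations, whose integrals agree on the former. *)
Lemma cE_cE a b Y : L2 Y -> ae_eq P setT (cE X a (cE X b Y)) (cE X (a :|: b) Y).
Proof.
move=> Y2; have Eb2 := cE_Lfun2 b Y2; have Eab2 := cE_Lfun2 (a :|: b) Y2.
have YEb := cE_is_condexp b Y2; have YEab := cE_is_condexp (a :|: b) Y2.
have abb : sigma_off X (a :|: b) `<=` sigma_off X b.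
  by apply: sigma_offS; exact: finset.subsetUr.
have aba : sigma_off X (a :|: b) `<=` sigma_off X a.
  by apply: sigma_offS; exact: finset.subsetUl.
apply: cE_unique => //; split; last first.
- apply: sigma_off_integral_eq => // _ [B mB <-].
  set D := fun w => cE X (a :|: b) Y w - cE X b Y w.
  have iD : L1 D by apply: Lfun2_integrable; exact: Lfun2B.
  pose A1 := \bigcap_(i in [set i | i \notin a :|: b]) X i @^-1` B i.
  pose A2 := \bigcap_(i in [set i | i \notin (~: (b :\: a))%SET]) X i @^-1` B i.
  have A1c : sigma_off X (a :|: b) A1 by apply: cylinder_sigma_off; exists B.
  have A2c : sigma_off X (~: (b :\: a))%SET A2.
    by apply: cylinder_sigma_off; exists B.
  have mA1 := sigma_off_measurable A1c; have mA2 := sigma_off_measurable A2c.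
  have -> : \bigcap_(i in [set i | i \notin a]) X i @^-1` B i = A2 `&` A1.
    apply/seteqP; split => w.
      move=> wB; split => i /= => [|ia]; last first.
        by apply: wB; move: ia; rewrite /= inE negb_or => /andP[].
      by rewrite !inE negbK => /andP[ia _]; exact: wB.
    move=> [w2 w1] i /= ia; case: (boolP (i \in b)) => ib.
      by apply: w2; rewrite /= !inE negbK ia.
    by apply: w1; rewrite /= inE negb_or ia.
  rewrite Rintegral_mkcondr.
  rewrite (@indep_integral _ _ _ P (gen_off b))//.
  + rewrite -Rintegral_mkcond RintegralB//.
    * rewrite /Rintegral; case: YEab => _ _ ->//.
      case: YEb => _ _ ->//; last exact: abb.
      by rewrite subrr mulr0.
    * by apply: (@integrableS _ _ _ _ setT) => //; exact: Lfun2_integrable.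
    * by apply: (@integrableS _ _ _ _ setT) => //; exact: Lfun2_integrable.
  + exact: sigma_off_measurable.
  + move=> A GA; apply: (@sigma_off_indep b (~: (b :\: a))%SET) => //.
    by apply/finset.setP => i; rewrite !inE; case: (i \in b); rewrite ?andbF.
  + have A1b : (gen_off b).-sigma.-measurable A1 by exact: (abb _ A1c).
    apply/(measurable_restrictT _ A1b); apply: measurable_funTS.
    apply: measurable_funB.
      apply/sub_sigma_measurableP => C mC; apply: abb.
      by case: YEab => + _ _; apply.
    exact: is_condexp_Gmeas YEb.
  + rewrite -restrict_EFin.
    apply: (proj1 (integrable_mkcond (EFin \o D) mA1)).
    exact: (@integrableS _ _ _ _ setT).
- exact: Lfun2_integrable.
- by move=> B mB; apply: aba; case: YEab => + _ _; apply.
Qed.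

Lemma cE_set0 Y : L2 Y ->
  (forall B : set R, measurable B -> sigma_off X finset.set0 (Y @^-1` B)) ->
  ae_eq P setT (cE X finset.set0 Y) Y.
Proof.
move=> Y2 mY; apply: cE_unique => //; split => //.
exact: Lfun2_integrable.
Qed.

Lemma cE_setT Y : L2 Y ->
  ae_eq P setT (cE X finset.setT Y) (cst (\int[P]_w Y w)).
Proof.
move=> Y2; apply: cE_unique => //; split.
- move=> B mB; rewrite preimage_cst; case: ifP => _.
    exact: (@measurableT _ (g_sigma_algebraType (gen_off finset.setT))).
  exact: (@measurable0 _ (g_sigma_algebraType (gen_off finset.setT))).
- exact: finite_measure_integrable_cst.
- have c2 : L2 (cst (\int[P]_w Y w)) by exact: Lfun_cst.
  apply: sigma_off_integral_eq => // _ [B mB <-].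
  (* No coordinate remains, so the only cylinder is the whole space. *)
  rewrite (_ : \bigcap_(_ in _) _ = setT); last first.
    by apply/seteqP; split=> w // _ i; rewrite /= inE.
  rewrite RintegralB//; try exact: Lfun2_integrable.
  by rewrite Rintegral_cst//= probability_setT mulr1 subrr.
Qed.

End cE_theory.

End coordinate_condexp.

(** * Expected iterated conditional variances *)

Section expected_cVar.
Context {d : measure_display} {T : measurableType d} {R : realType}.
Variable P : probability T R.
Variables (n : nat) (X : 'I_n -> {RV P >-> R}).
Hypothesis indX : mutually_independent X.
Local Notation L1 f := (P.-integrable setT (EFin \o f)).
Local Notation L2 f := (f \in Lfun P 2%:E).
Local Notation "a =ae b" := (ae_eq P setT a b) (at level 70).
Local Notation cE1 i := (cE X (finset.set1 i)).
Implicit Types (a b : {set 'I_n}) (Y Z : T -> R) (s : seq 'I_n).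

Definition sqnorm Y : R := \int[P]_w (Y w ^+ 2).

Lemma eq_sqnorm Y Z : L2 Y -> L2 Z -> Y =ae Z -> sqnorm Y = sqnorm Z.
Proof.
move=> Y2 Z2 YZ; congr fine; apply: ae_eq_integral => //.
- by have := Lfun2_integrable_sqr Y2 => /measurable_int.
- by have := Lfun2_integrable_sqr Z2 => /measurable_int.
- by apply: filterS YZ => w /(_ I) ->.
Qed.

Lemma sqnorm_ge0 Y : 0 <= sqnorm Y.
Proof. by apply: Rintegral_ge0 => w _; exact: sqr_ge0. Qed.

(** Pythagoras: $Y - E^a Y$ is orthogonal to $E^a Y$. *)
Lemma sqnorm_sub_cE a Y : L2 Y ->
  sqnorm (fun w => Y w - cE X a Y w) = sqnorm Y - sqnorm (cE X a Y).
Proof.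
move=> Y2; have Z2 := cE_Lfun2 X a Y2.
have iYY := Lfun2_integrable_sqr Y2; have iZZ := Lfun2_integrable_sqr Z2.
have iYZ := Lfun2_integrableM Y2 Z2.
have YZE : \int[P]_w (cE X a Y w ^+ 2 - Y w * cE X a Y w) = 0.
  by rewrite RintegralB// cE_ortho// subrr.
transitivity (\int[P]_w ((Y w ^+ 2 - cE X a Y w ^+ 2) +
    (cE X a Y w ^+ 2 - Y w * cE X a Y w) * 2)).
  by apply: eq_Rintegral => w _; ring.
have i1 : L1 (fun w => Y w ^+ 2 - cE X a Y w ^+ 2).
  exact: (integrableB measurableT iYY iZZ).
have i2 : L1 (fun w => cE X a Y w ^+ 2 - Y w * cE X a Y w).
  exact: (integrableB measurableT iZZ iYZ).
rewrite RintegralD//; last exact: (integrableZr measurableT 2%R i2).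
by rewrite RintegralZr// YZE mul0r addr0 RintegralB.
Qed.

(* The recursion defining [cVar], read on expectations. *)
Fixpoint alt_sqnorm s Y : R :=
  if s is i :: s' then alt_sqnorm s' Y - alt_sqnorm s' (cE1 i Y) else sqnorm Y.

Lemma cE_integral a Y : L1 Y ->
  L1 (cE X a Y) /\ \int[P]_w cE X a Y w = \int[P]_w Y w.
Proof.
move=> iY; have [_ iE YE] := condexp_is (@sigma_off_measurable _ _ _ P _ X a) iY.
split=> //; congr fine; apply: YE.
exact: (@measurableT _ (g_sigma_algebraType (gen_off X a))).
Qed.

(** The outer $E^{(i)}$ disappears under expectation. The empty list is excluded because [cVar] is
    then 0 while [alt_sqnorm] is the squared norm; the induction starts at singletons. *)
Lemma cVar_integral s Y : L2 Y -> s != [::] ->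
  L1 (cVar X s Y) /\ \int[P]_w cVar X s Y w = alt_sqnorm s Y.
Proof.
elim: s Y => [//|i [|j s] IH] Y Y2 _.
  have iYY := Lfun2_integrable_sqr Y2.
  have iEE := Lfun2_integrable_sqr (cE_Lfun2 X [set i]%SET Y2).
  have [iE EE] := cE_integral [set i]%SET iYY.
  split; first exact: (integrableB measurableT iE iEE).
  by rewrite /cVar RintegralB// EE.
have [iV VE] := IH Y Y2 erefl.
have [iV' VE'] := IH _ (cE_Lfun2 X [set i]%SET Y2) erefl.
have [iE EE] := cE_integral [set i]%SET iV.
split; first exact: (integrableB measurableT iE iV').
rewrite [LHS](_ : _ = \int[P]_w (cE1 i (cVar X (j :: s) Y) w -
  cVar X (j :: s) (cE1 i Y) w))//.
by rewrite RintegralB// EE VE VE'.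
Qed.

(** The product of the operators $1 - E^{(i)}$, for [i] in [s], applied to [Y]. *)
Fixpoint center s Y : T -> R :=
  if s is i :: s' then fun w => center s' Y w - cE1 i (center s' Y) w else Y.

Lemma center_Lfun2 s Y : L2 Y -> L2 (center s Y).
Proof.
by move=> Y2; elim: s => [//|i s IH] /=; apply: Lfun2B => //; exact: cE_Lfun2.
Qed.

(** The conditional expectations commute almost surely, both composites being $E^{a \cup \{i\}}$. *)
Lemma cE_center a s Y : L2 Y -> cE X a (center s Y) =ae center s (cE X a Y).
Proof.
move=> Y2; elim: s => [|i s IH] /=; first exact: ae_eq_refl.
set Z := center s Y in IH *; have Z2 : L2 Z := center_Lfun2 s Y2.
have Ea2 := cE_Lfun2 X a Z2; have Ei2 := cE_Lfun2 X [set i]%SET Z2.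
have Ca2 := center_Lfun2 s (cE_Lfun2 X a Y2).
apply: ae_eq_trans; first exact: cEB.
have -> : cE1 i (center s (cE X a Y)) = cE1 i (cE X a Z).
  by apply: eq_cE => //; exact: ae_eq_sym.
apply: (@ae_eq_sub _ _ _ P setT _ _ _ _ _ IH).
apply: ae_eq_trans; first exact: cE_cE.
by rewrite finset.setUC; apply: ae_eq_sym; exact: cE_cE.
Qed.

(** Each level of the recursion is one use of Pythagoras, after moving $E^{(i)}$ through [center].
    This is the source of nonnegativity of the Hoeffding coefficients. *)
Lemma alt_sqnormE s Y : L2 Y -> alt_sqnorm s Y = sqnorm (center s Y).
Proof.
elim: s Y => [//|i s IH] Y Y2 /=; have Z2 := center_Lfun2 s Y2.
rewrite sqnorm_sub_cE// IH// IH; last exact: cE_Lfun2.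
congr (_ - _); apply/esym/eq_sqnorm; last exact: cE_center.
- exact: cE_Lfun2.
- by apply: center_Lfun2; exact: cE_Lfun2.
Qed.

(** The two terms of the recursion correspond to the subsets without [i] and with [i], since $E^u
    E^{(i)} = E^{u \cup \{i\}}$. The condition on $E^\emptyset$ identifies the term of the empty set
    and passes to $E^{(i)} Y$. *)
Lemma alt_sqnorm_sum s Y : uniq s -> L2 Y -> cE X finset.set0 Y =ae Y ->
  alt_sqnorm s Y = \sum_(u : {set 'I_n} | u \subset [set i in s]%SET)
     (-1) ^+ #|u| * sqnorm (cE X u Y).
Proof.
elim: s Y => [|i s IH] Y /= us Y2 Y0.
  rewrite (big_pred1 finset.set0) => [|u]; last first.
    by rewrite finset.set_nil finset.subset0.
  rewrite finset.cards0 expr0 mul1r; apply: eq_sqnorm => //; last exact: ae_eq_sym.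
  exact: cE_Lfun2.
move: us => /andP[si us]; have Ei2 := cE_Lfun2 X [set i]%SET Y2.
rewrite IH// IH//; last by rewrite -{2}(finset.set0U [set i]%SET); exact: cE_cE.
rewrite finset.set_cons sum_subset_setU1 ?inE//.
rewrite -sumrN; congr (_ + _); apply: eq_bigr => u us'.
have iu : i \notin u.
  by apply: contra si => /(fintype.subsetP us'); rewrite inE.
rewrite finset.cardsU1 iu exprS mulN1r mulNr; congr (- (_ * _)).
rewrite finset.setUC; apply: eq_sqnorm; last exact: cE_cE.
- by do 2 apply: cE_Lfun2.
- exact: cE_Lfun2.
Qed.

End expected_cVar.

(** * Binomial sums *)

Section binomial_sums.
Variable R : realFieldType.

Lemma sum_sign_bin_lt m k :
  \sum_(0 <= j < k.+1) (-1) ^+ j * 'C(m.+1, j)%:R = (-1) ^+ k * 'C(m, k)%:R :> R.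
Proof.
elim: k => [|k IH]; first by rewrite big_nat1 !bin0.
by rewrite big_nat_recr//= IH binS natrD exprS; ring.
Qed.

(** Truncated inclusion-exclusion, with the term $j = 0$ replaced by the indicator of $m > 0$ so
    that $m = 0$ is covered too. *)
Lemma sum_sign_bin m k :
  (0 < m)%:R + \sum_(1 <= j < k.+1) (-1) ^+ j * 'C(m, j)%:R =
  (-1) ^+ k * ((0 < m)%:R * 'C(m.-1, k)%:R) :> R.
Proof.
case: m => [|m] /=.
  rewrite mul0r mulr0 add0r big_nat_cond big1// => j /andP[/andP[j0 _] _].
  by rewrite bin0n eqn0Ngt j0 mulr0.
by rewrite mul1r -sum_sign_bin_lt [RHS]big_nat_recl//= bin0 mul1r big_add1.
Qed.

(** By Pascal's rule, a finite difference of order $k + 1$ is one of order $k$ applied to the first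
    difference. *)
Lemma sum_sign_bin_diff k (f : nat -> R) :
  \sum_(0 <= j < k.+2) (-1) ^+ j * 'C(k.+1, j)%:R * f j =
  \sum_(0 <= j < k.+1) (-1) ^+ j * 'C(k, j)%:R * (f j - f j.+1).
Proof.
rewrite big_nat_recl//= !bin0 expr0 !mul1r.
under eq_bigr do rewrite binS natrD mulrDr mulrDl.
rewrite big_split/=.
under [RHS]eq_bigr do rewrite mulrBr.
rewrite sumrB [X in _ = X - _]big_nat_recl//= bin0 expr0 !mul1r -addrA.
congr (_ + _).
rewrite big_nat_recr//= [X in _ * X%:R]bin_small// mulr0 mul0r addr0; congr (_ + _).
by rewrite -sumrN; apply: eq_bigr => j _; rewrite exprS; ring.
Qed.

(** Each difference in [j] lowers both arguments of the binomial by one. The lower index [n - p]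
    replaces [p - k], whose truncated subtraction would be wrong for $p < k$. *)
Lemma sum_sign_bin_bin k n p : (k <= n)%N -> (p <= n)%N ->
  \sum_(0 <= j < k.+1) (-1) ^+ j * 'C(k, j)%:R * 'C(n - j, p)%:R =
  'C(n - k, n - p)%:R :> R.
Proof.
elim: k n p => [|k IH] n p kn pn.
  by rewrite big_nat1 expr0 !mul1r subn0 bin_sub.
rewrite (sum_sign_bin_diff _ (fun j => 'C(n - j, p)%:R)).
case: n p kn pn => [//|n] [|p] kn pn.
  rewrite big1 => [|j _]; last by rewrite !bin0 subrr mulr0.
  by rewrite bin_small// subn0 subSS ltnS leq_subr.
rewrite !subSS -IH//; apply: eq_big_nat => j /andP[_ jk]; congr (_ * _).
have jn : (j <= n)%N := leq_trans jk kn.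
by rewrite subSS (subSn jn) binS natrD; ring.
Qed.

(** Both sides count chains of a [j]-set inside an [m]-set inside an [n]-set; [n - m] stands for
    [m - j] so that $j > m$ gives zero. *)
Lemma mul_bin_bin n m j : (m <= n)%N ->
  ('C(m, j) * 'C(n, m) = 'C(n, j) * 'C(n - j, n - m))%N.
Proof.
move=> mn; have [jm|mj] := leqP j m; last first.
  rewrite bin_small// mul0n; have [nj|jn] := leqP j n; last by rewrite bin_small.
  by rewrite [X in (_ * X)%N]bin_small ?muln0//; lia.
have jn := leq_trans jm mn.
have E1 := bin_fact jm; have E2 := bin_fact mn; have E3 := bin_fact jn.
have nmj : (n - m <= n - j)%N by exact: leq_sub2l.
have := bin_fact nmj; rewrite (_ : n - j - (n - m) = m - j)%N => [E4|]; last by lia.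
apply/eqP; rewrite -(eqn_pmul2r (fact_gt0 j)) -(eqn_pmul2r (fact_gt0 (m - j))).
rewrite -(eqn_pmul2r (fact_gt0 (n - m))); apply/eqP.
transitivity n`!; first by rewrite -E2 -E1; ring.
by rewrite -E3 -E4; ring.
Qed.

(** Rewriting $C(m,j)/C(n,j)$ as $C(n-j,n-m)/C(n,m)$ reduces this to [sum_sign_bin_bin] with $p = n
    - m$. *)
Lemma sum_sign_bin_ratio n m k : (m <= n)%N -> (k <= n)%N ->
  \sum_(0 <= j < k.+1) (-1) ^+ j * ('C(k, j)%:R / 'C(n, j)%:R) * 'C(m, j)%:R =
  'C(n - k, m)%:R / 'C(n, m)%:R :> R.
Proof.
move=> mn kn; have nm0 : 'C(n, m)%:R != 0 :> R.
  by rewrite pnatr_eq0 -lt0n bin_gt0.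
apply: (canRL (mulfK nm0)).
have := @sum_sign_bin_bin _ _ _ kn (leq_subr m n); rewrite subKn// => <-.
rewrite big_distrl/=.
apply: eq_big_nat => j /andP[_ jk].
have nj0 : 'C(n, j)%:R != 0 :> R.
  by rewrite pnatr_eq0 -lt0n bin_gt0 (leq_trans _ kn).
have E : 'C(m, j)%:R * 'C(n, m)%:R = 'C(n, j)%:R * 'C(n - j, n - m)%:R :> R.
  by rewrite -!natrM mul_bin_bin.
by rewrite -!mulrA E mulKf.
Qed.

End binomial_sums.

(** * Sums weighted by a function of the cardinality *)

Section card_weighted_sums.
Variables (R : realFieldType) (n : nat) (c : {set 'I_n} -> R).
Implicit Types f g : nat -> R.

Definition wsum f : R := \sum_(A : {set 'I_n}) f #|A| * c A.

Lemma eq_wsum f g : (forall m, (m <= n)%N -> f m = g m) -> wsum f = wsum g.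
Proof.
move=> fg; apply: eq_bigr => A _; rewrite fg//.
by rewrite -[leqRHS]card_ord max_card.
Qed.

Lemma le_wsum f g : (forall A, 0 <= c A) ->
  (forall m, (m <= n)%N -> f m <= g m) -> wsum f <= wsum g.
Proof.
move=> c0 fg; apply: ler_sum => A _; rewrite ler_wpM2r// fg//.
by rewrite -[leqRHS]card_ord max_card.
Qed.

Lemma wsumD f g : wsum f + wsum g = wsum (fun m => f m + g m).
Proof. by rewrite /wsum -big_split; apply: eq_bigr => A _; rewrite mulrDl. Qed.

Lemma wsumB f g : wsum f - wsum g = wsum (fun m => f m - g m).
Proof. by rewrite /wsum -sumrB; apply: eq_bigr => A _; rewrite mulrBl. Qed.

Lemma wsumZ x f : x * wsum f = wsum (fun m => x * f m).
Proof. by rewrite big_distrr; apply: eq_bigr => A _; rewrite /= mulrA. Qed.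

Lemma wsum_sum p q (F : nat -> nat -> R) :
  \sum_(p <= j < q) wsum (F j) = wsum (fun m => \sum_(p <= j < q) F j m).
Proof.
rewrite exchange_big; apply: eq_bigr => A _.
by rewrite big_distrl.
Qed.

End card_weighted_sums.

(** [wsum] is linear in its weight and, as $c \ge 0$, monotone, so each assertion is checked on
    weights at every $m \le n$. *)
Lemma card_weighted_identities (R : realFieldType) (n : nat)
    (c : {set 'I_n} -> R) (V : R) (J K : nat -> R) :
  (forall A, 0 <= c A) ->
  V = wsum c (fun m => (0 < m)%:R) ->
  (forall k, (0 < k)%N -> J k = wsum c (fun m => 'C(m, k)%:R)) ->
  (forall k, (0 < k)%N -> K k = wsum c (fun m => (m == k)%:R)) ->
  [/\ V = \sum_(1 <= j < n.+1) (-1) ^+ (j - 1) * J j,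
      V = \sum_(1 <= j < n.+1) K j
    & forall k : nat, (1 <= k <= n - 1)%N ->
      [/\ K k.+1 <= (-1) ^+ k * (V + \sum_(1 <= j < k.+1) (-1) ^+ j * J j)
            <= J k.+1,
          K k.+1 <= V - \sum_(1 <= j < k.+1) K j <= J k.+1,
          V = \sum_(1 <= j < k.+1) (-1) ^+ (j - 1) * J j
               + (-1) ^+ k * \sum_(k.+1 <= j < n.+1) 'C(j - 1, k)%:R * K j
        & V = \sum_(1 <= j < k.+1)
                   (-1) ^+ (j - 1) * ('C(k, j)%:R / 'C(n, j)%:R) * J j
               + \sum_(1 <= j < (n - k).+1)
                   'C(n - k, j)%:R / 'C(n, j)%:R * K j]].
Proof.
move=> c0 VE JE KE.
have sumJ (x : nat -> R) q : \sum_(1 <= j < q) x j * J j =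
    wsum c (fun m => \sum_(1 <= j < q) x j * 'C(m, j)%:R).
  rewrite -wsum_sum; apply: eq_big_nat => j /andP[j0 _].
  by rewrite JE// wsumZ.
have sumK (x : nat -> R) p q : (0 < p)%N -> \sum_(p <= j < q) x j * K j =
    wsum c (fun m => (p <= m < q)%:R * x m).
  move=> p0.
  transitivity (\sum_(p <= j < q) wsum c (fun m => x j * (m == j)%:R)).
    apply: eq_big_nat => j /andP[pj _].
    by rewrite KE ?(leq_trans p0)// wsumZ.
  rewrite wsum_sum; apply: eq_wsum => m _; case: (boolP (p <= m < q)%N) => mpq.
    rewrite (bigD1_seq m) ?mem_index_iota ?iota_uniq//= eqxx.
    rewrite big1 ?mulr1 ?addr0 ?mul1r// => j jm.
    by rewrite eq_sym (negbTE jm) mulr0.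
  rewrite mul0r big_nat_cond big1// => j /andP[jpq _].
  by case: eqP mpq => [->|]; rewrite ?jpq// mulr0.
have sumK1 q : \sum_(1 <= j < q) K j = wsum c (fun m => (1 <= m < q)%:R).
  transitivity (\sum_(1 <= j < q) 1 * K j).
    by apply: eq_bigr => j _; rewrite mul1r.
  by rewrite (sumK (fun=> 1))//; apply: eq_wsum => m _; rewrite mulr1.
have sgnE (x : nat -> R) q : \sum_(1 <= j < q) (-1) ^+ (j - 1) * x j =
    - \sum_(1 <= j < q) (-1) ^+ j * x j.
  rewrite -sumrN; apply: eq_big_nat => j /andP[j0 _].
  have -> : (-1) ^+ j = - (-1) ^+ (j - 1) :> R.
    by rewrite -{1}(subnK j0) addn1 exprS mulN1r.
  by rewrite mulNr opprK.
have sumJs q : \sum_(1 <= j < q.+1) (-1) ^+ (j - 1) * J j =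
    wsum c (fun m => (0 < m)%:R - (-1) ^+ q * ((0 < m)%:R * 'C(m.-1, q)%:R)).
  rewrite (sumJ (fun j => (-1) ^+ (j - 1))); apply: eq_wsum => m _.
  by rewrite sgnE -sum_sign_bin; ring.
split.
- rewrite sumJs VE; apply: eq_wsum => m mn; case: m mn => [|m] mn.
    by rewrite !mul0r mulr0 subr0.
  by rewrite bin_small// !mulr0 subr0.
- by rewrite sumK1 VE; apply: eq_wsum => m mn; rewrite ltnS mn andbT.
move=> k /andP[k0 kn].
have kn' : (k <= n)%N by lia.
(* The weight is $C(m-1,k)$ for $m > 0$; it lies between the indicator of $m = k+1$ and $C(m,k+1)$
   by Pascal's rule. *)
have mid : (-1) ^+ k * (V + \sum_(1 <= j < k.+1) (-1) ^+ j * J j) =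
    wsum c (fun m => (0 < m)%:R * 'C(m.-1, k)%:R).
  rewrite (sumJ (fun j => (-1) ^+ j)) VE wsumD wsumZ; apply: eq_wsum => m _.
  by rewrite sum_sign_bin signrMK.
split.
- rewrite mid JE// KE//; apply/andP; split; apply: le_wsum => // -[|m] mn;
    rewrite /= ?mul0r ?mul1r ?ler0n//.
    by rewrite eqSS; case: eqP => [->|]; rewrite ?binn ?ler0n.
  by rewrite ler_nat binS leq_addl.
(* The middle term has as weight the indicator of $m > k$. *)
- rewrite sumK1 VE wsumB JE// KE//; apply/andP; split; apply: le_wsum => // m mn.
    by case: (ltngtP m k.+1); case: m mn => //= m mn; rewrite ?ltnS ?subr0 ?subrr//.
  have [km|mk] := ltnP k m.
    have m0 : (0 < m)%N := leq_ltn_trans (leq0n _) km.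
    rewrite m0 ltnS leqNgt km/= subr0 (_ : 1 = 1%:R)// ler_nat bin_gt0//.
  by rewrite ltnS mk andbT subrr.
(* The remainder weight $C(m-1,k)$ vanishes for $0 < m \le k$, hence only the [K j] with $j > k$
   occur. *)
- rewrite sumJs (sumK (fun j => 'C(j - 1, k)%:R))// wsumZ wsumD VE.
  apply: eq_wsum => -[|m] mn.
    by rewrite !mul0r !mulr0 ?mul0r ?mulr0 subr0 addr0.
  rewrite subn1/= mul1r; have [km|mk] := ltnP k m.+1.
    by rewrite ltnS mn mul1r subrK.
  by rewrite bin_small// !mulr0 subr0 addr0.
- rewrite (sumJ (fun j => (-1) ^+ (j - 1) * ('C(k, j)%:R / 'C(n, j)%:R))).
  rewrite (sumK (fun j => 'C(n - k, j)%:R / 'C(n, j)%:R))// wsumD VE.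
  apply: eq_wsum => m mn.
  under eq_bigr do rewrite -mulrA.
  rewrite sgnE; under eq_bigr do rewrite mulrA.
  (* Its term $j = 0$ is 1, the weight of [V] for $m > 0$; the right-hand side is the weight of the
     [K] sum, and it is zero once $m > n - k$. *)
  have := sum_sign_bin_ratio R mn kn'.
  rewrite (@big_ltn _ _ _ 0)// expr0 !bin0 invr1 !mul1r.
  case: (posnP m) => [->|m0] E.
    rewrite mul0r addr0 big_nat_cond big1 ?oppr0// => j /andP[/andP[j0 _] _].
    by rewrite bin0n eqn0Ngt j0 mulr0.
  rewrite ltnS; have [mk|km] := leqP m (n - k).
    by rewrite mul1r -E addrCA addNr addr0.
  rewrite mul0r addr0; move: E; rewrite bin_small// mul0r => /eqP.
  by rewrite addr_eq0 => /eqP.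
Qed.

(** * Variance, [J'] and [K'] in terms of Hoeffding coefficients *)

Section influences.
Context {d : measure_display} {T : measurableType d} {R : realType}.
Variable P : probability T R.
Variables (n : nat) (X : 'I_n -> {RV P >-> R}).
Hypothesis indX : mutually_independent X.
Local Notation L2 f := (f \in Lfun P 2%:E).

Lemma expectation_sum_tuple k (F : k.-tuple 'I_n -> T -> R) :
  (forall t, P.-integrable setT (EFin \o F t)) ->
  fine 'E_P[fun w => \sum_(t : k.-tuple 'I_n | uniq t) F t w] =
  \sum_(t : k.-tuple 'I_n | uniq t) \int[P]_w F t w.
Proof.
move=> iF; rewrite unlock; under eq_integral do rewrite -sumEFin.
rewrite integral_sum// -sum_fine// => t _.
exact: (integrable_fin_num measurableT (iF t)).
Qed.

Let tuple_neq0 k (t : k.+1.-tuple 'I_n) : val t != [::].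
Proof. by rewrite -size_eq0 size_tuple. Qed.

Variable Y : T -> R.
Hypotheses (Y2 : L2 Y) (Y0 : ae_eq P setT (cE X finset.set0 Y) Y).

Let g (a : {set 'I_n}) := sqnorm P (cE X a Y).

Lemma J'E k : (0 < k)%N -> J' X Y k = wsum (hoeffding g) (fun m => 'C(m, k)%:R).
Proof.
case: k => // k _; rewrite /J' /J expectation_sum_tuple; last first.
  by move=> t; have [] := cVar_integral X Y2 (tuple_neq0 t).
rewrite (eq_bigr (fun t : k.+1.-tuple 'I_n => alt_sum g [set i in t]%SET)).
  rewrite sum_uniq_tuple sum_alt_sum_card mulrC mulKf//.
move=> t ut; have [_ ->] := cVar_integral X Y2 (tuple_neq0 t).
exact: alt_sqnorm_sum.
Qed.

(** Composing $E^u$ with $E^{s^c}$ gives $E^{u \cup s^c}$, the shift built into [hoeffding]. *)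
Lemma alt_sqnorm_cE s : uniq s ->
  alt_sqnorm X s (cE X (~: [set i in s])%SET Y) = hoeffding g [set i in s]%SET.
Proof.
move=> us; have E2 := cE_Lfun2 X (~: [set i in s])%SET Y2.
rewrite alt_sqnorm_sum//; last first.
  by rewrite -{2}(finset.set0U (~: [set i in s])%SET); exact: cE_cE.
apply: eq_bigr => u _; congr (_ * _); apply: eq_sqnorm; last exact: cE_cE.
- exact: cE_Lfun2.
- exact: cE_Lfun2.
Qed.

Lemma hoeffding_sqnorm_ge0 A : 0 <= hoeffding g A.
Proof.
have <- : [set i in fintype.enum A]%SET = A.
  by apply/finset.setP => i; rewrite inE mem_enum.
rewrite -alt_sqnorm_cE ?enum_uniq// alt_sqnormE ?sqnorm_ge0//.
exact: cE_Lfun2.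
Qed.

Lemma K'E k : (0 < k)%N -> K' X Y k = wsum (hoeffding g) (fun m => (m == k)%:R).
Proof.
case: k => // k _; rewrite /K' /K expectation_sum_tuple; last first.
  move=> t; pose a := (~: [set i in t])%SET.
  by have [] := cVar_integral X (cE_Lfun2 X a Y2) (tuple_neq0 t).
rewrite (eq_bigr (fun t : k.+1.-tuple 'I_n => hoeffding g [set i in t]%SET)).
  rewrite sum_uniq_tuple mulrC mulKf//.
  rewrite big_mkcond; apply: eq_bigr => A _.
  by case: eqP => _; rewrite ?mul1r ?mul0r.
move=> t ut; pose a := (~: [set i in t])%SET.
have [_ ->] := cVar_integral X (cE_Lfun2 X a Y2) (tuple_neq0 t).
exact: alt_sqnorm_cE.
Qed.

(** The variance is [g finset.set0 - g finset.setT]; inversion turns the first term into the sum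
    over all sets and the second into the component of the empty set. *)
Lemma varianceE_hoeffding :
  fine 'V_P[Y] = wsum (hoeffding g) (fun m => (0 < m)%:R).
Proof.
have iYY := Lfun2_integrable_sqr Y2; have iY := Lfun2_integrable Y2.
transitivity (g finset.set0 - g finset.setT).
  rewrite varianceE// unlock fineB ?integrable_fin_num//; last first.
    by rewrite fin_numX// integrable_fin_num.
  congr (_ - _); first exact/esym/eq_sqnorm/Y0/Y2/cE_Lfun2.
  rewrite /g (@eq_sqnorm _ _ _ _ _ (cst (\int[P]_w Y w)))//.
  - rewrite /sqnorm/= Rintegral_cst//= probability_setT mulr1.
    by rewrite fineM// ?expr2// integrable_fin_num.
  - exact: cE_Lfun2.
  - exact: Lfun_cst.
  - exact: cE_setT.
rewrite -[X in g X - _]finset.setCT -[X in _ - g X]finset.setC0 !moebius.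
rewrite [X in _ - X](big_pred1 finset.set0) => [|A]; last by rewrite finset.subset0.
rewrite (bigD1 finset.set0) ?finset.sub0set//= addrAC subrr add0r.
rewrite /wsum [RHS](bigD1 finset.set0)//= finset.cards0 mul0r add0r.
apply: eq_big => [A|A /andP[_ A0]]; first by rewrite finset.subsetT.
by rewrite lt0n finset.cards_eq0 A0 mul1r.
Qed.

End influences.

Theorem proposition1p5 (R : realType) (d : measure_display)
    (T : measurableType d) (P : probability T R)
    (n : nat) (hn : (1 <= n)%N)
    (X X' : 'I_n -> {RV P >-> R})
    (hind : mutually_independent (join_family X X'))
    (hid : forall k : 'I_n, identically_distributed (X k) (X' k))
    (S : n.-tuple R -> R) (hS : measurable_fun [set: n.-tuple R] S)
    (hS2 : ('E_P[fun w => (S [tuple X i w | i < n] ^+ 2)%R] < +oo)%E) :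
  let SX : T -> R := fun w => S [tuple X i w | i < n] in
  let VarS : R := fine 'V_P[SX] in
  let J' := J' X SX in
  let K' := K' X SX in
  [/\ VarS = \sum_(1 <= j < n.+1) (-1) ^+ (j - 1) * J' j,
      VarS = \sum_(1 <= j < n.+1) K' j
    & forall k : nat, (1 <= k <= n - 1)%N ->
      [/\ K' k.+1 <=
            (-1) ^+ k * (VarS + \sum_(1 <= j < k.+1) (-1) ^+ j * J' j)
            <= J' k.+1,
          K' k.+1 <= VarS - \sum_(1 <= j < k.+1) K' j <= J' k.+1,
          VarS = \sum_(1 <= j < k.+1) (-1) ^+ (j - 1) * J' j
               + (-1) ^+ k * \sum_(k.+1 <= j < n.+1) 'C(j - 1, k)%:R * K' j
        & VarS = \sum_(1 <= j < k.+1)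
                   (-1) ^+ (j - 1) * ('C(k, j)%:R / 'C(n, j)%:R) * J' j
               + \sum_(1 <= j < (n - k).+1)
                   'C(n - k, j)%:R / 'C(n, j)%:R * K' j]].

Proof.
(* Independence of the joined family is restricted to index sets in the image of [inl]. *)
have indX : mutually_independent X.
  move=> J B mB.
  pose B2 (i : 'I_n + 'I_n) := match i with inl j | inr j => B j end.
  have mB2 i : measurable (B2 i) by case: i.
  have := hind (inl @: J)%SET B2 mB2.
  rewrite big_imset/=; last by move=> i j _ _ [].
  move=> <-.
  congr (P _); apply/seteqP; split=> w wB i.
    by move=> /imsetP[j jJ ->]; exact: wB.
  by move=> iJ; apply: (wB (inl i)); apply/imsetP; exists i.
move=> SX VarS.
(* Being a Borel function of all the coordinates, [SX] is fixed by $E^\emptyset$ up to a null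
   set. *)
have mSX : forall B : set R, measurable B ->
    sigma_off X finset.set0 (SX @^-1` B).
  pose TX := g_sigma_algebraType (gen_off X finset.set0).
  pose tX (w : TX) := [tuple X i w | i < n].
  have mtX : measurable_fun setT tX.
    apply/measurable_fun_tnthP => i.
    rewrite (_ : _ \o _ = X i); last first.
      by apply/funext => w; rewrite /= tnth_mktuple.
    move=> _ B mB; rewrite setTI; apply: sub_sigma_algebra.
    by exists i; rewrite /= ?inE//; exists B => //; rewrite setTI.
  have mStX : measurable_fun setT (S \o tX) by exact: measurableT_comp.
  by move=> B mB; rewrite -[SX @^-1` B]setTI; exact: mStX.
have SX2 : SX \in Lfun P 2%:E.
  apply: sqr_integrable_Lfun2; last by rewrite unlock in hS2.
  by move=> _ B mB; rewrite setTI; apply: sigma_off_measurable; exact: mSX.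
have SX0 : ae_eq P setT (cE X finset.set0 SX) SX by exact: cE_set0.
apply: (card_weighted_identities (hoeffding_sqnorm_ge0 indX SX2)).
- exact: varianceE_hoeffding.
- exact: J'E.
- exact: K'E.
Qed.
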